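(* Let $(X,E)$ be an mq-space. Then $(D(X),\triangle_E,\nabla_E)$ is a simple m-lattice if and only if $(\triangle_E,\nabla_E)$ is simple and $X=\overline{\min X\cup\max X}$ (closure in the topology of $X$).
   Context: Notation: $E(Z)=\{y:(x,y)\in E$ for some $x\in Z\}$; in a poset $(Y]$, $[Y)$ are the generated down-/up-sets; $\min X$, $\max X$ are the minimal/maximal elements. A Priestley space is a compact space with a partial order such that whenever $x\not\le y$ there is a clopen increasing $U$ with $x\in U$, $y\notin U$; $D(X)$ is its set of clopen increasing subsets (a bounded distributive lattice under $\cap,\cup$). A q-space is $(X,E)$ with $X$ Priestley, $E$ an equivalence relation with $E(U)\in D(X)$ for $U\in D(X)$ and closed classes. An mq-space is a q-space with (mq1) $(x,y)\in E$, $y\le z$ imply some $w$ with $x\le w$, $(w,z)\in E$; (mq2) $(E(X\setminus V)]$ clopen for all $V\in D(X)$. Define $\nabla_E U=E(U)$, $\triangle_E U=X\setminus(E(X\setminus U)]$ on $D(X)$; $(D(X),\triangle_E,\nabla_E)$ is an m-lattice (bounded distributive lattice with operations satisfying the monadic axioms). The pair $(\triangle_E,\nabla_E)$ is simple if $\nabla_E\emptyset=\emptyset$, $\nabla_E U=X$ for $U\ne\emptyset$, and $\triangle_E X=X$, $\triangle_E U=\emptyset$ for $U\ne X$. Simple means having exactly two congruences.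
   Formalization: The space X is assumed nonempty: for X empty the right-hand side holds vacuously, while D(X) is the one-element lattice with only one congruence, hence not simple. *)

(* Defs.v *)
From HB Require Import structures.
From mathcomp Require Import all_boot all_order.
From mathcomp Require Import all_classical all_analysis.

Set Implicit Arguments.
Unset Strict Implicit.
Unset Printing Implicit Defensive.

Import Order.TTheory.

Local Open Scope classical_set_scope.
Local Open Scope order_scope.

Section order_sets.
Context {d : Order.disp_t} {X : porderType d}.
Implicit Types U : set X.

Definition increasing U := forall x y, U x -> x <= y -> U y.
Definition downset U : set X := [set x | exists2 y, U y & x <= y].
Definition min_elts : set X := [set x | forall y, y <= x -> y = x].
Definition max_elts : set X := [set x | forall y, x <= y -> y = x].
End order_sets.
Arguments min_elts {d} X.
Arguments max_elts {d} X.

Definition clopen_up {d : Order.disp_t} {X : POrderedTopological.type d} :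
  set (set X) := [set U | clopen U /\ increasing U].

HB.mixin Record isPriestley (d : Order.disp_t) X of POrderedTopological d X := {
  priestley_compact : compact [set: X] ;
  priestley_sep : forall x y : X, ~ (x <= y) ->
    exists U : set X, [/\ clopen_up U, U x & ~ U y]
}.

#[short(type="priestleyType")]
HB.structure Definition Priestley (d : Order.disp_t) :=
  { X of POrderedTopological d X & isPriestley d X }.

Section clopen_up_closed.
Context {d : Order.disp_t} {X : priestleyType d}.
Implicit Types U V : set X.

Lemma clopen_up0 : clopen_up (set0 : set X).
Proof. by split; [exact: clopen0|]. Qed.

Lemma clopen_upT : clopen_up [set: X].
Proof. by split; [exact: clopenT|]. Qed.

Lemma clopen_upI U V : clopen_up U -> clopen_up V -> clopen_up (U `&` V)%classic.
Proof.
move=> [cU iU] [cV iV]; split; first exact: clopenI.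
by move=> x y [Ux Vx] xy; split; [exact: iU xy|exact: iV xy].
Qed.

Lemma clopen_upU U V : clopen_up U -> clopen_up V -> clopen_up (U `|` V)%classic.
Proof.
move=> [cU iU] [cV iV]; split; first exact: clopenU.
by move=> x y [Ux|Vx] xy; [left; exact: iU xy|right; exact: iV xy].
Qed.
End clopen_up_closed.

Section dual_lattice.
Context {d : Order.disp_t} (X : priestleyType d).

Record dual_lattice := DualLattice {
  dual_set :> set X ;
  _ : dual_set \in @clopen_up d X }.

HB.instance Definition _ := [isSub for dual_set].
HB.instance Definition _ := [Choice of dual_lattice by <:].

Let dual_closedI : {in mem (@clopen_up d X) &,
  forall U V, U `&` V \in mem (@clopen_up d X)}.
Proof. by move=> U V /set_mem DU /set_mem DV; apply/mem_set/clopen_upI. Qed.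

Let dual_closedU : {in mem (@clopen_up d X) &,
  forall U V, U `|` V \in mem (@clopen_up d X)}.
Proof. by move=> U V /set_mem DU /set_mem DV; apply/mem_set/clopen_upU. Qed.

Let dual_closed0 : (\bot : set X) \in mem (@clopen_up d X).
Proof. exact/mem_set/clopen_up0. Qed.

Let dual_closed1 : (\top : set X) \in mem (@clopen_up d X).
Proof. exact/mem_set/clopen_upT. Qed.

HB.instance Definition _ :=
  Order.SubChoice_isTBSubLattice.Build set_display (set X)
    (mem (@clopen_up d X)) set_display dual_lattice
    dual_closedI dual_closedU dual_closed0 dual_closed1.
End dual_lattice.

Section dual_lattice_distr.
Context {d : Order.disp_t} (X : priestleyType d).
Implicit Types U V : dual_lattice X.

Lemma dual_latticeP U : clopen_up (U : set X).
Proof. exact/set_mem/(valP U). Qed.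

Lemma dual_setI U V : dual_set (U `&` V)%O = (dual_set U `&` dual_set V)%classic.
Proof. by []. Qed.

Lemma dual_setU U V : dual_set (U `|` V)%O = (dual_set U `|` dual_set V)%classic.
Proof. by []. Qed.

Lemma dual_set0 : dual_set (\bot : dual_lattice X) = set0.
Proof. by []. Qed.

Lemma dual_setT : dual_set (\top : dual_lattice X) = setT.
Proof. by []. Qed.

Let dual_meetUl : @left_distributive (dual_lattice X) _ Order.meet Order.join.
Proof. by move=> U V W; apply: val_inj; exact: setIUl. Qed.

Let dual_joinIl : @left_distributive (dual_lattice X) _ Order.join Order.meet.
Proof. by move=> U V W; apply: val_inj; exact: setUIl. Qed.

HB.instance Definition _ :=
  Order.Lattice_isDistributive.Build set_display (dual_lattice X)
    dual_meetUl dual_joinIl.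
End dual_lattice_distr.

(** Monadic distributive lattices: [nab] is a quantifier on the bounded
    distributive lattice [L] and [tri] is the companion interior operator, with
    the axioms of monadic Heyting algebras that do not involve implication. *)
Section m_lattice.
Context {d : Order.disp_t} {L : tbDistrLatticeType d}.
Implicit Types (tri nab : L -> L) (theta : L -> L -> Prop) (a b c e : L).

Record m_lattice tri nab : Prop := MLattice {
  nab0 : nab \bot = \bot ;
  nab_ge : forall a, a <= nab a ;
  nab_meet : forall a b, nab (a `&` nab b) = nab a `&` nab b ;
  nab_join : forall a b, nab (a `|` b) = nab a `|` nab b ;
  tri1 : tri \top = \top ;
  tri_le : forall a, tri a <= a ;
  tri_meet : forall a b, tri (a `&` b) = tri a `&` tri b ;
  nab_tri : forall a, nab (tri a) = tri a ;
  tri_nab : forall a, tri (nab a) = nab a }.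

Record congruence tri nab theta : Prop := Congruence {
  cong_refl : forall a, theta a a ;
  cong_sym : forall a b, theta a b -> theta b a ;
  cong_trans : forall a b c, theta a b -> theta b c -> theta a c ;
  cong_meet : forall a b c e, theta a b -> theta c e ->
    theta (a `&` c) (b `&` e) ;
  cong_join : forall a b c e, theta a b -> theta c e ->
    theta (a `|` c) (b `|` e) ;
  cong_tri : forall a b, theta a b -> theta (tri a) (tri b) ;
  cong_nab : forall a b, theta a b -> theta (nab a) (nab b) }.

Definition simple_m_lattice tri nab : Prop :=
  m_lattice tri nab /\
  exists theta1 theta2 : L -> L -> Prop, theta1 <> theta2 /\
    [set theta | congruence tri nab theta] = [set theta1; theta2].
End m_lattice.

Section mq_space.
Context {d : Order.disp_t} {X : priestleyType d}.
Implicit Types (E : X -> X -> Prop) (U V Z : set X).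

Definition rel_image E Z : set X := [set y | exists2 x, Z x & E x y].

Record q_space E : Prop := QSpace {
  q_refl : forall x, E x x ;
  q_sym : forall x y, E x y -> E y x ;
  q_trans : forall x y z, E x y -> E y z -> E x z ;
  q_clopen_up : forall U, clopen_up U -> clopen_up (rel_image E U) ;
  q_closed : forall x, closed [set y | E x y] }.

Record mq_space E : Prop := MQSpace {
  mq_q_space :> q_space E ;
  mq1 : forall x y z, E x y -> y <= z -> exists2 w, x <= w & E w z ;
  mq2 : forall V, clopen_up V -> clopen (downset (rel_image E (~` V))) }.

Definition nabla E U : set X := rel_image E U.
Definition triangle E U : set X := ~` downset (rel_image E (~` U)).

Definition simple_pair E : Prop :=
  [/\ nabla E set0 = set0,
      forall U, clopen_up U -> U <> set0 -> nabla E U = setT,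
      triangle E setT = setT
    & forall U, clopen_up U -> U <> setT -> triangle E U = set0].

Lemma clopen_up_nabla E U : mq_space E -> clopen_up U -> clopen_up (nabla E U).
Proof. by move=> hE; apply: (q_clopen_up hE). Qed.

Lemma clopen_up_triangle E U :
  mq_space E -> clopen_up U -> clopen_up (triangle E U).
Proof.
move=> hE DU; have [oU cU] := mq2 hE DU; split.
  by split; [exact: closed_openC|exact: open_closedC].
by move=> x y nx xy [z Ez yz]; apply: nx; exists z => //; exact: le_trans yz.
Qed.

Definition dual_nabla E (hE : mq_space E) (U : dual_lattice X) :
    dual_lattice X :=
  DualLattice (mem_set (clopen_up_nabla hE (dual_latticeP U))).

Definition dual_triangle E (hE : mq_space E) (U : dual_lattice X) :
    dual_lattice X :=
  DualLattice (mem_set (clopen_up_triangle hE (dual_latticeP U))).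

Lemma dual_m_lattice E (hE : mq_space E) :
  m_lattice (dual_triangle hE) (dual_nabla hE).
Proof.
have [[rE sE] tE] := (q_refl hE, q_sym hE, q_trans hE).
have nab_sub U : U `<=` nabla E U by move=> x Ux; exists x.
have tri_sub U : triangle E U `<=` U.
  move=> x nx; apply: contrapT => Ux; apply: nx.
  by exists x => //; exists x.
split.
- by apply: val_inj; rewrite /= -subset0 => y [x].
- by move=> U; apply/asboolP; exact: nab_sub.
- move=> U V; apply: val_inj => /=; apply/seteqP; split=> y.
    move=> [x [Ux [z Vz zx]] xy]; split; first by exists x.
    by exists z => //; exact: tE zx xy.
  move=> [[x Ux xy] [z Vz zy]]; exists x => //; split=> //.
  by exists z => //; exact: tE zy (sE _ _ xy).
- move=> U V; apply: val_inj => /=; apply/seteqP; split=> y.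
    by move=> [x [Ux|Vx] xy]; [left|right]; exists x.
  by move=> [[x Ux xy]|[x Vx xy]]; exists x => //; [left|right].
- apply: val_inj; apply/seteqP; split=> //= x _ [y [z nz _] _]; exact: nz.
- by move=> U; apply/asboolP; exact: tri_sub.
- move=> U V; apply: val_inj => /=; apply/seteqP; split=> x.
    move=> nx; split=> -[y [z nz zy] xy]; apply: nx; exists y => //;
    by exists z => // -[].
  move=> [nU nV] [y [z nz zy] xy].
  have [Uz|nUz] := pselect (dual_set U z).
    by apply: nV; exists y => //; exists z => // Vz; exact: nz.
  by apply: nU; exists y => //; exists z.
- move=> U; apply: val_inj => /=; apply/seteqP; split=> x; last exact: nab_sub.
  move=> [y ny yx] [z [u nu uz] xz]; apply: ny.
  have [w yw wz] := mq1 hE yx xz.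
  by exists w => //; exists u => //; exact: tE uz (sE _ _ wz).
- move=> U; apply: val_inj => /=; apply/seteqP; split=> x; first exact: tri_sub.
  move=> Ux [y [z nz zy] xy]; apply: nz.
  have [_ up] := clopen_up_nabla hE (dual_latticeP U).
  have [u Uu uy] := up _ _ Ux xy.
  by exists u => //; exact: tE uy (sE _ _ zy).
Qed.
End mq_space.

(* Main.v *)
Require Import Defs.
From mathcomp Require Import all_boot all_order.
From mathcomp Require Import all_classical all_analysis.

Import Order.TTheory.

Local Open Scope classical_set_scope.

(** A congruence identifying two distinct clopen up-sets [U] and [V] also
    identifies [U `&` V] with [U `|` V], whose difference is a nonempty open
    set and so contains an extremal point [x].  If [x] is maximal, some clopen
    up-set [W] contains [x] and misses [U `&` V]; intersecting with [W] and
    applying [nabla] identifies the empty set with [X].  If [x] is minimal one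
    argues dually with [triangle].  Conversely, if [e] is fixed by both
    operators then [a `&` e = b `&` e] is a congruence in [a] and [b], so in a
    simple m-lattice [e] is trivial; this makes the pair of operators simple.
    Agreement on the extremal points is then a congruence too, since by
    compactness every point lies between a minimal and a maximal one. *)

(** * Congruences of an abstract m-lattice *)

Section Congruences.
Context {d : Order.disp_t} {L : tbDistrLatticeType d}.
Implicit Types (tri nab : L -> L) (theta : L -> L -> Prop).
Local Open Scope order_scope.

Lemma nab_idem tri nab a : m_lattice tri nab -> nab (nab a) = nab a.
Proof.
move=> mL; have nab1 : nab \top = \top.
  by apply: le_anti; rewrite lex1 (nab_ge mL).
by rewrite -{1}[nab a]meet1x (nab_meet mL) nab1 meet1x.
Qed.

Lemma tri_idem tri nab a : m_lattice tri nab -> tri (tri a) = tri a.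
(* [tri a] is itself a value of [nab], and [tri] fixes those. *)
Proof. by move=> mL; rewrite -{1}(nab_tri mL a) (tri_nab mL) (nab_tri mL). Qed.

Lemma congruence_eq tri nab : congruence tri nab eq.
Proof. by split=> //; congruence. Qed.

Lemma congruence_full tri nab : congruence tri nab (fun _ _ => True).
Proof. by []. Qed.

Lemma congruence_bot_top_full tri nab theta :
  congruence tri nab theta -> theta \bot \top -> forall a b, theta a b.
Proof.
move=> ct bt.
have all_bot a : theta \bot a.
  by have := cong_meet ct bt (cong_refl ct a); rewrite meet0x meet1x.
by move=> a b; exact: (cong_trans ct (cong_sym ct (all_bot a))).
Qed.

(** Equality and the full relation are always congruences, and they differ once [\bot <> \top];
    having exactly two congruences therefore means having no others. The full relation is recognised
    by its identifying [\bot] with [\top]. *)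
Lemma simple_m_latticeP tri nab : m_lattice tri nab -> \bot <> \top :> L ->
  simple_m_lattice tri nab <->
  forall theta, congruence tri nab theta ->
    theta \bot \top \/ forall a b, theta a b -> a = b.
Proof.
move=> mL nbt; split=> [[_ [t1 [t2 [_ tE]]]] theta ct|simp].
  have in12 t : congruence tri nab t -> t = t1 \/ t = t2.
    by move=> ctt; have : [set t | congruence tri nab t] t by []; rewrite tE.
  have neq : @eq L <> (fun _ _ => True).
    by move=> /(congr1 (fun t => t \bot \top)) e; apply: nbt; rewrite e.
  have [<-|nt] := pselect ((fun _ _ => True) = theta); first by left.
  have [<-|ne] := pselect (eq = theta); first by right.
  by case: (in12 _ ct) (in12 _ (congruence_eq tri nab))
    (in12 _ (congruence_full tri nab)) => ? [] ? [] ?; congruence.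
split=> //; exists eq, (fun _ _ => True); split.
  by move=> /(congr1 (fun t => t \bot \top)) e; apply: nbt; rewrite e.
apply/seteqP; split=> theta /=; last first.
  by case=> ->; [exact: congruence_eq|exact: congruence_full].
move=> ct; have [bt|te] := simp _ ct; [right|left].
  apply/funext => a; apply/funext => b; apply/propext; split=> // _.
  exact: congruence_bot_top_full ct bt a b.
apply/funext => a; apply/funext => b; apply/propext; split; first exact: te.
by move=> ->; exact: cong_refl ct b.
Qed.

(** Because [e] is fixed, [nab a] meet [e] equals [nab] of [a] meet [e], and likewise for [tri], so
    both depend only on [a] meet [e]. *)
Lemma congruence_meet_fixed tri nab e : m_lattice tri nab ->
  nab e = e -> tri e = e -> congruence tri nab (fun a b => a `&` e = b `&` e).
Proof.
move=> mL ne te; split=> //.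
- by move=> a b c -> ->.
- move=> a b c f ab cf.
  by rewrite -[e]meetxx meetACA ab cf meetACA.
- by move=> a b c f ab cf; rewrite !meetUl ab cf.
- by move=> a b ab; rewrite -te -!(tri_meet mL) ab.
- by move=> a b ab; rewrite -ne -!(nab_meet mL) ne ab.
Qed.

Lemma simple_fixed tri nab e : m_lattice tri nab -> \bot <> \top :> L ->
  simple_m_lattice tri nab -> nab e = e -> tri e = e -> e = \bot \/ e = \top.
Proof.
move=> mL nbt /(simple_m_latticeP _ _ mL nbt) simp ne te.
have [] := simp _ (congruence_meet_fixed _ _ _ mL ne te).
  by rewrite meet0x meet1x; left.
(* [e] and [\top] have the same meet with [e]. *)
by move=> /(_ e \top); rewrite meetxx meet1x; right; auto.
Qed.

End Congruences.

(** If every member of [F] met [K], the traces on [K] would generate a proper filter; its cluster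
    point in [K] would lie in every member of [F], as these are closed. *)
Lemma compact_directed_disjoint {T : topologicalType} (K : set T)
    (F : set (set T)) : compact K -> F !=set0 ->
  (forall A, F A -> closed A) ->
  (forall A B, F A -> F B -> exists2 C, F C & C `<=` A `&` B) ->
  (forall x, K x -> exists2 A, F A & ~ A x) ->
  exists2 A, F A & A `&` K = set0.
Proof.
move=> cK [A0 FA0] clF dirF missF; apply: contrapT => nF.
have meetK A : F A -> (A `&` K) !=set0.
  by move=> FA; apply/set0P/eqP => AK0; apply: nF; exists A.
have fF : ProperFilter (filter_from F (fun A => A `&` K)).
  apply: filter_from_proper => //.
  apply: filter_from_filter; first by exists A0.
  move=> A B FA FB; have [C FC CAB] := dirF _ _ FA FB; exists C => // x [Cx Kx].
  by have [] := CAB x Cx.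
have [|p [Kp clp]] := cK _ fF; first by exists A0 => // x [].
have [A FA nAp] := missF p Kp.
have [||x [[Ax _] nAx]] := clp (A `&` K) (~` A); first by exists A.
  by apply: open_nbhs_nbhs; split; [exact: closed_openC (clF _ FA)|exact: nAp].
exact: nAx.
Qed.

(** Zorn's lemma on the cone over [x]: a chain without upper bound would yield a directed family of
    closed cones without common point, so by compactness an empty one, yet each contains its apex. A
    general [R] serves both the order and its converse. *)
Lemma compact_extremal_above {T : topologicalType} (R : rel T) :
  compact [set: T] -> (forall x, R x x) ->
  (forall x y z, R x y -> R y z -> R x z) ->
  (forall x y, R x y -> R y x -> x = y) ->
  (forall x, closed [set y | R x y]) ->
  forall x, exists2 m, R x m & forall y, R m y -> y = m.
Proof.
move=> cT Rxx Rtr Ran clR x.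
pose T' := {y | R x y}.
pose R' : rel T' := fun y z => R (sval y) (sval z).
have [m mmax] : exists m, forall s, R' m s -> s = m.
  apply: Zorn => [y|y z t|y z yz zy|C totC]; first exact: Rxx.
  - exact: Rtr.
  - by case: y z yz zy => [y xy] [z xz] yz zy; apply: eq_exist; exact: Ran.
  have [->|/set0P[c0 Cc0]] := eqVneq C set0.
    by exists (exist _ x (Rxx x)).
  (* A bound found anywhere in [T] lies above [c0], hence above [x]. *)
  have [|no] := pselect (exists t, forall s, C s -> R (sval s) t).
    move=> [t ub].
    by exists (exist _ t (Rtr _ _ _ (svalP c0) (ub _ Cc0))) => s /ub.
  pose F := [set [set y | R (sval c) y] | c in C].
  have [||||A [c Cc <-] /seteqP[/(_ (sval c)) dis _]] :=
      compact_directed_disjoint [set: T] F cT.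
  - by exists [set y | R (sval c0) y]; exists c0.
  - by move=> _ [c _ <-]; exact: clR.
  - move=> _ _ [a Ca <-] [b Cb <-].
    have [ab|ba] := totC _ _ Ca Cb.
      exists [set y | R (sval b) y]; first by exists b.
      by move=> y Rby; split=> //; exact: Rtr Rby.
    exists [set y | R (sval a) y]; first by exists a.
    by move=> y Ray; split=> //; exact: Rtr Ray.
  - move=> y _; apply: contrapT => ny; apply: no; exists y => s Cs.
    apply: contrapT => nsy; apply: ny.
    by exists [set y | R (sval s) y] => //; exists s.
  by case: dis; split=> //=; exact: Rxx.
exists (sval m); first exact: (svalP m).
move=> y my; have xy := Rtr _ _ _ (svalP m) my.
by rewrite -(mmax (exist _ y xy) my).
Qed.

(** * Extremal points and separation in Priestley spaces *)

Section Priestley.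
Context {d : Order.disp_t} {X : priestleyType d}.
Implicit Types (x : X) (U V W K : set X).
Local Open Scope order_scope.
Local Open Scope classical_set_scope.

Lemma closed_compact_priestley K : closed K -> compact K.
Proof. by move=> cK; apply: subclosed_compact cK priestley_compact _. Qed.

Lemma closed_upset x : closed [set y | x <= y].
Proof.
have -> : [set y | x <= y] = \bigcap_(U in [set U | clopen_up U /\ U x]) U.
  apply/seteqP; split=> [y xy U [[_ iU] Ux]|y yU]; first exact: iU xy.
  apply: contrapT => /priestley_sep[U [DU Ux nUy]].
  by apply: nUy; exact: (yU U).
by apply: closed_bigI => U [[[]]].
Qed.

Lemma closed_downset x : closed [set y | y <= x].
Proof.
have -> : [set y | y <= x] =
    \bigcap_(U in [set U | clopen_up U /\ ~ U x]) (~` U).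
  apply/seteqP; split=> [y yx U [[_ iU] nUx] Uy|y yU].
    by apply: nUx; exact: iU yx.
  apply: contrapT => /priestley_sep[U [DU Uy nUx]].
  exact: (yU U).
by apply: closed_bigI => U [[[]]] oU _ _ _; exact: open_closedC.
Qed.

Lemma max_above x : exists2 m, max_elts X m & x <= m.
Proof.
have [] // := @compact_extremal_above X (fun y z => y <= z) _ _ _ _ _ x.
- exact: priestley_compact.
- by move=> y z t; exact: le_trans.
- by move=> y z yz zy; apply: le_anti; rewrite yz.
- exact: closed_upset.
- by move=> m; exists m.
Qed.

Lemma min_below x : exists2 m, min_elts X m & m <= x.
Proof.
have [] // := @compact_extremal_above X (fun y z => z <= y) _ _ _ _ _ x.
- exact: priestley_compact.
- by move=> y z t zy tz; exact: le_trans zy.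
- by move=> y z yz zy; apply: le_anti; rewrite yz zy.
- exact: closed_downset.
- by move=> m; exists m.
Qed.

(** The differences of clopen up-sets that contain [x] are closed and directed, and each point other
    than [x] is missed by one of them. *)
Lemma priestley_basis x K : closed K -> ~ K x -> exists U V,
  [/\ clopen_up U, clopen_up V, U x, ~ V x & K `&` U `<=` V].
Proof.
move=> cK nKx.
pose F := [set A | exists U V,
  [/\ clopen_up U, clopen_up V, U x, ~ V x & A = U `\` V]].
have [||||A [U [V [DU DV Ux nVx ->]]] /seteqP[dis _]] :=
    compact_directed_disjoint K F (closed_compact_priestley _ cK).
- exists (setT `\` set0), setT, set0.
  by split=> //; [exact: clopen_upT|exact: clopen_up0].
- move=> _ [U [V [[[_ cU] _] [[oV _] _] _ _ ->]]].
  by apply: closedI => //; exact: open_closedC.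
- move=> _ _ [U [V [DU DV Ux nVx ->]]] [U' [V' [DU' DV' Ux' nVx' ->]]].
  exists ((U `&` U') `\` (V `|` V')).
    exists (U `&` U'), (V `|` V'); split=> //; last by case.
      exact: clopen_upI.
    exact: clopen_upU.
  by move=> y [[Uy U'y] /not_orP[nVy nV'y]].
- move=> y Ky; have [xy|/priestley_sep[U [DU Ux nUy]]] := pselect (x <= y).
    have [yx|/priestley_sep[V [DV Vy nVx]]] := pselect (y <= x).
      by case: nKx; have -> : x = y by apply: le_anti; rewrite xy.
    exists (setT `\` V); last by case.
    by exists setT, V; split=> //; exact: clopen_upT.
  exists (U `\` set0); last by case.
  by exists U, set0; split=> //; exact: clopen_up0.
exists U, V; split=> // y [Ky Uy]; apply: contrapT => nVy.
exact: (dis y).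
Qed.

(** By maximality no point of [U] is above [x], so each is missed by some clopen up-set around [x];
    compactness of [U] gives a single one. *)
Lemma max_elts_sep x U : max_elts X x -> clopen_up U -> ~ U x ->
  exists W, [/\ clopen_up W, W x & W `&` U = set0].
Proof.
move=> mx [[_ cU] _] nUx.
have [||||W [DW Wx] WU] := compact_directed_disjoint U
    [set W | clopen_up W /\ W x] (closed_compact_priestley _ cU).
- by exists setT; split=> //; exact: clopen_upT.
- by move=> W [[[]]].
- move=> W W' [DW Wx] [DW' Wx']; exists (W `&` W') => //.
  by split=> //; exact: clopen_upI.
- move=> y Uy; have [|W [DW Wx nWy]] := @priestley_sep _ X x y.
    by move=> /mx yx; apply: nUx; rewrite -yx.
  by exists W.
by exists W.
Qed.

Lemma min_elts_sep x V : min_elts X x -> clopen_up V -> V x ->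
  exists W, [/\ clopen_up W, ~ W x & W `|` V = setT].
Proof.
move=> mx [[oV _] _] Vx.
have [||||_ [W [DW nWx] <-] /seteqP[WV _]] := compact_directed_disjoint (~` V)
    [set ~` W | W in [set W | clopen_up W /\ ~ W x]]
    (closed_compact_priestley _ (open_closedC oV)).
- by exists (~` set0); exists set0 => //; split=> //; exact: clopen_up0.
- by move=> _ [W [[[oW _] _] _] <-]; exact: open_closedC.
- move=> _ _ [W [DW nWx] <-] [W' [DW' nWx'] <-]; exists (~` (W `|` W')).
    by exists (W `|` W') => //; split; [exact: clopen_upU|case].
  by rewrite setCU.
- move=> y nVy; have [|W [DW Wy nWx]] := @priestley_sep _ X y x.
    by move=> /mx yx; apply: nVy; rewrite yx.
  by exists (~` W); [exists W|apply].
exists W; split=> //; apply/seteqP; split=> // y _.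
by apply: contrapT => /not_orP[nWy nVy]; exact: (WV y).
Qed.

End Priestley.

(** * The m-lattice of clopen up-sets of an mq-space *)

Section MqSpace.
Context {d : Order.disp_t} {X : priestleyType d}.
Context {E : X -> X -> Prop} (hE : mq_space E).
Implicit Types (U V : dual_lattice X).
Local Open Scope order_scope.

Local Notation nab := (dual_nabla hE).
Local Notation tri := (dual_triangle hE).

Lemma dual_set_inj U V : dual_set U = dual_set V -> U = V.
Proof. exact: val_inj. Qed.

Lemma dual_bot_neq_top : [set: X] !=set0 -> \bot <> \top :> dual_lattice X.
Proof.
move=> [x _] /(congr1 (fun U => dual_set U x)).
by rewrite dual_set0 dual_setT => e; rewrite -[False]/(set0 x) e.
Qed.

(** Values of [nab] and of [tri] are fixed by both operators, hence trivial; [nab U] contains [U]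
    and [tri U] is contained in it, which decides between [\bot] and [\top]. *)
Lemma simple_m_lattice_pair : [set: X] !=set0 ->
  simple_m_lattice tri nab -> simple_pair E.
Proof.
move=> hX simp; have mL := dual_m_lattice hE.
have triv := simple_fixed _ _ _ mL (dual_bot_neq_top hX) simp.
split.
- exact: (congr1 (@dual_set d X) (nab0 mL)).
- move=> U DU nU0; pose U' := DualLattice (mem_set DU).
  have [e|e] := triv (nab U') (nab_idem _ _ U' mL) (tri_nab mL U').
    case: nU0; apply/seteqP; split=> // x Ux.
    by rewrite -dual_set0 -e; exists x => //; exact: (q_refl hE).
  exact: (congr1 (@dual_set d X) e).
- exact: (congr1 (@dual_set d X) (tri1 mL)).
- move=> U DU nUT; pose U' := DualLattice (mem_set DU).
  have [e|e] := triv (tri U') (nab_tri mL U') (tri_idem _ _ U' mL).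
    exact: (congr1 (@dual_set d X) e).
  case: nUT; apply/seteqP; split=> // x _.
  have : dual_set (tri U') x by rewrite e.
  apply: contra_notP => nUx; exists x => //; exists x => //.
  exact: (q_refl hE).
Qed.

(** A simple pair only tests whether a set is all of [X] or empty. Extremal points detect both: an
    up-set containing all minimal points is everything, and one without maximal points is empty. *)
Lemma congruence_extremal : simple_pair E ->
  congruence tri nab (fun U V =>
    forall x, (min_elts X `|` max_elts X)%classic x ->
      (dual_set U x <-> dual_set V x)).
Proof.
move=> [nab0 nab1 tri1 tri0].
split=> //.
- by move=> U V UV x /UV[].
- by move=> U V W UV VW x Sx; rewrite (UV x Sx); exact: VW.
- by move=> U V W Z UV WZ x Sx; rewrite !dual_setI /setI /= (UV x Sx) (WZ x Sx).
- by move=> U V W Z UV WZ x Sx; rewrite !dual_setU /setU /= (UV x Sx) (WZ x Sx).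
- have full U V : (forall x, (min_elts X `|` max_elts X)%classic x ->
      (dual_set U x <-> dual_set V x)) ->
      dual_set U = setT -> dual_set V = setT.
    move=> UV UT; apply/seteqP; split=> // y _.
    have [m mm my] := min_below y.
    have [_ iV] := dual_latticeP V.
    by apply: iV my; apply/(UV m (or_introl mm)); rewrite UT.
  move=> U V UV x _ /=.
  have [UT|nUT] := pselect (dual_set U = setT).
    by rewrite UT (full U V UV UT).
  have nVT : dual_set V <> setT.
    by move=> /(full V U) VU; apply: nUT; apply: VU => y /UV[].
  by rewrite (tri0 _ (dual_latticeP U) nUT) (tri0 _ (dual_latticeP V) nVT).
- have empty U V : (forall x, (min_elts X `|` max_elts X)%classic x ->
      (dual_set U x <-> dual_set V x)) ->
      dual_set U = set0 -> dual_set V = set0.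
    move=> UV U0; apply/seteqP; split=> // y Vy.
    have [m mm ym] := max_above y.
    have [_ iV] := dual_latticeP V.
    by have /(UV m (or_intror mm)) := iV _ _ Vy ym; rewrite U0.
  move=> U V UV x _ /=.
  have [U0|nU0] := pselect (dual_set U = set0).
    by rewrite U0 (empty U V UV U0).
  have nV0 : dual_set V <> set0.
    by move=> /(empty V U) VU; apply: nU0; apply: VU => y /UV[].
  by rewrite (nab1 _ (dual_latticeP U) nU0) (nab1 _ (dual_latticeP V) nV0).
Qed.

Lemma simple_m_lattice_closure : [set: X] !=set0 ->
  simple_m_lattice tri nab -> [set: X] = closure (min_elts X `|` max_elts X).
Proof.
move=> hX simp; have mL := dual_m_lattice hE.
have ct := congruence_extremal (simple_m_lattice_pair hX simp).
have /(simple_m_latticeP _ _ mL (dual_bot_neq_top hX)) cong := simp.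
apply/seteqP; split=> // x _; apply: contrapT => nSx.
have [bt|eqS] := cong _ ct.
  have [m mm _] := max_above x.
  by have [_ /(_ I)] := bt m (or_intror mm).
have [U [V [DU DV Ux nVx KUV]]] :=
  priestley_basis _ _ (@closed_closure _ _) nSx.
apply: nVx.
pose U' := DualLattice (mem_set DU); pose V' := DualLattice (mem_set DV).
(* The two sides agree on extremal points, where [U] is contained in [V], but differ at [x]. *)
suff e : U' = U' `&` V' by have : dual_set U' x by []; rewrite e => -[].
apply: eqS => y Sy; split=> [Uy|[]//]; split=> //.
by apply: KUV; split=> //; exact: subset_closure.
Qed.

Lemma simple_pair_simple_m_lattice : [set: X] !=set0 -> simple_pair E ->
  [set: X] = closure (min_elts X `|` max_elts X) -> simple_m_lattice tri nab.
Proof.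
move=> hX [nab0 nab1 tri1 tri0] dense; have mL := dual_m_lattice hE.
apply/(simple_m_latticeP _ _ mL (dual_bot_neq_top hX)) => theta ct.
have [[U [V [UV neq]]]|no] := pselect (exists U V, theta U V /\ U <> V);
  last by right=> U V UV; apply: contrapT => neq; apply: no; exists U, V.
left.
have [x [Vx nUx Sx]] : exists x, [/\ dual_set (U `|` V)%O x,
    ~ dual_set (U `&` V)%O x & (min_elts X `|` max_elts X)%classic x].
  have oVU : open (dual_set (U `|` V)%O `\` dual_set (U `&` V)%O).
    apply: openI; first by have [[]] := dual_latticeP (U `|` V).
    by apply: closed_openC; have [[]] := dual_latticeP (U `&` V).
  have [x [Vx nUx]] :
      (dual_set (U `|` V)%O `\` dual_set (U `&` V)%O)%classic !=set0.
    apply/set0P/eqP => /seteqP[e _]; apply: neq; apply: dual_set_inj.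
    apply/seteqP; split=> y Uy; apply: contrapT => nVy; apply: (e y).
      by split; [left|case].
    by split; [right|case].
  have : closure (min_elts X `|` max_elts X) x by rewrite -dense.
  move=> /(_ _ (open_nbhs_nbhs (conj oVU (conj Vx nUx))))[y [Sy Oy]].
  by exists y; case: Oy.
have {UV neq} : theta (U `&` V) (U `|` V).
  have UVV : theta (U `&` V) V.
    by have := cong_meet ct UV (cong_refl ct V); rewrite meetxx.
  apply: (cong_trans ct UVV).
  by have := cong_join ct (cong_sym ct UV) (cong_refl ct V); rewrite joinxx.
(* From here on [U] and [V] denote the former meet and join, so [x] lies in [V] but not in [U]. *)
move: (U `&` V) (U `|` V) nUx Vx => {}U {}V nUx Vx UV.
case: Sx => mx.
  have [W [DW nWx WV]] := min_elts_sep _ _ mx (dual_latticeP V) Vx.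
  pose W' := DualLattice (mem_set DW).
  (* [W] joined with [V] is all of [X], while [W] joined with [U] misses [x]. *)
  have := cong_tri ct (cong_join ct (cong_refl ct W') UV).
  suff [-> ->] : tri (W' `|` U) = \bot /\ tri (W' `|` V) = \top by [].
  split; apply: dual_set_inj.
    apply: (tri0 _ (dual_latticeP (W' `|` U))) => /seteqP[_ /(_ x I)].
    by case.
  exact: etrans (congr1 (triangle E) WV) tri1.
have [W [DW Wx WU]] := max_elts_sep _ _ mx (dual_latticeP U) nUx.
pose W' := DualLattice (mem_set DW).
(* [W] is disjoint from [U], while [W] and [V] share [x]. *)
have := cong_nab ct (cong_meet ct (cong_refl ct W') UV).
suff [-> ->] : nab (W' `&` U) = \bot /\ nab (W' `&` V) = \top by [].
split; apply: dual_set_inj; first exact: etrans (congr1 (nabla E) WU) nab0.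
by apply: (nab1 _ (dual_latticeP (W' `&` V))) => /seteqP[/(_ x)+ _]; apply.
Qed.

End MqSpace.

Theorem theorem2p3 (d : Order.disp_t) (X : priestleyType d)
    (E : X -> X -> Prop) (hE : mq_space E) (hX : [set: X] !=set0) :
  simple_m_lattice (dual_triangle hE) (dual_nabla hE) <->
  simple_pair E /\ [set: X] = closure (min_elts X `|` max_elts X).
Proof.
split=> [simp|[sp dense]].
  split; first exact: simple_m_lattice_pair simp.
  exact: simple_m_lattice_closure simp.
exact: simple_pair_simple_m_lattice.
Qed.
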